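(* Let $X$ be an ordered linear space satisfying $X_+ = \{0\} \cup \operatorname{int} X_+$, such that the cone $X_+$ is generating for $X$ and $X_+$ has bounded aperture on parallel lines. Let $Y$ be a Dedekind complete ordered linear space such that the cone $Y_+$ is generating for $Y$. Let $\mathcal L$ be a linear space of linear maps $X \to Y$ for which there is some $y_0 \in Y$ such that for every regular linear functional $f : X \to \mathbb R$ the map $x \mapsto f(x)\, y_0$ belongs to $\mathcal L$. Then the following conditions are equivalent. (1) $X$ has the Riesz Decomposition Property. (2) $X$ has the $\mathcal L$-Riesz Decomposition Property.
   Context: All linear spaces are over $\mathbb R$. An ordered linear space $X$ is a linear space with a partial order such that $x \geqslant y$ and $\lambda \geqslant 0$ imply $x+z \geqslant y+z$ and $\lambda x \geqslant \lambda y$; $X_+ = \{x : x \geqslant 0\}$. $X_+$ is generating for $X$ if $X = X_+ - X_+$. The order interval is $[x,y] = \{z : x \leqslant z \leqslant y\}$. Sums of sets are Minkowski sums. $Y$ is Dedekind complete if every nonempty subset of $Y$ having an upper bound has a supremum. For a subset $A$ of a linear space $X$, $\operatorname{int} A$ is the set of internal points of $A$: points $e \in A$ such that for every $x \in X$ there is $\varepsilon > 0$ with $e + \alpha x \in A$ for all $\alpha \in (-\varepsilon, \varepsilon)$. A linear functional is positive if it is nonnegative on $X_+$, and regular if it is a difference of two positive linear functionals. A base of $X_+$ is a convex set $B \subset X_+\setminus\{0\}$ such that every $x \in X_+ \setminus \{0\}$ is $x = \lambda y$ for unique $y \in B$, $\lambda > 0$; equivalently, $B = \{x \in X_+ : f(x)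 = 1\}$ for a linear functional $f$ on $X$ with $f>0$ on $X_+ \setminus \{0\}$. $X_+$ has bounded aperture on parallel lines if it has a base $B$ such that for every $x \in X$, $x \neq 0$, there is $c_x \geqslant 0$ such that for every $y \in B \setminus \{x\}$ the length of $B \cap \ell$ is at most $c_x$, where $\ell$ is the line through $y$ and $x+y$ and length along $\ell$ is measured in units of $x$ (the length of the segment between $y+sx$ and $y+tx$ is $|s-t|$). This does not depend on the choice of the base. $X$ has the Riesz Decomposition Property if $[0,x]+[0,y] = [0,x+y]$ for all $x,y \in X_+$. A linear map $f : X \to Y$ strictly separates a point $z \in X$ from a convex set $A \subset X$ if either $f(z) \leqslant f(a)$ for all $a \in A$ and $f(z) < \inf f(A)$, or $f(z) \geqslant f(a)$ for all $a \in A$ and $f(z) > \sup f(A)$. $X$ satisfies the $\mathcal L$-Riesz Decomposition Property if for all $x, y \in X_+$ no point $z \in [0,x+y] \setminus ([0,x]+[0,y])$ can be strictly separated from $[0,x]+[0,y]$ by a map from $\mathcal L$.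
   Formalization: The vector y_0 is required to satisfy y_0 > 0; the statement allows any y_0 in Y, but is then false (e.g. y_0 = 0, L = {0}, X = R^3 with {0} and the open Lorentz cone, which lacks the Riesz Decomposition Property). *)

(* Defs.v *)
From HB Require Import structures.
From mathcomp Require Import all_boot all_order all_algebra.
From mathcomp Require Import all_classical all_reals all_analysis.

Set Implicit Arguments.
Unset Strict Implicit.
Unset Printing Implicit Defensive.

Import Order.TTheory GRing.Theory Num.Theory.

Local Open Scope classical_set_scope.
Local Open Scope ring_scope.

(* MathComp's [Num.POrderedZmodule] only joins an order with a group structure:
   the compatibility axioms are all in this mixin. *)
HB.mixin Record POrderedZmodule_isOrderedLmodule (R : numDomainType) X
    of Num.POrderedZmodule X & GRing.Lmodule R X := {
  olerD2r : forall x y z : X, y <= x -> y + z <= x + z ;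
  olerZ2l : forall (l : R) (x y : X), 0 <= l -> y <= x -> l *: y <= l *: x
}.

#[short(type="orderedLmodType")]
HB.structure Definition OrderedLmodule (R : numDomainType) :=
  { X of POrderedZmodule_isOrderedLmodule R X
       & Num.POrderedZmodule X & GRing.Lmodule R X }.

Definition poscone (R : numDomainType) (X : orderedLmodType R) : set X :=
  [set x | 0 <= x].
Arguments poscone {R} X.

Definition minkowski_sum (R : numDomainType) (X : lmodType R) (A B : set X) :
  set X := [set a + b | a in A & b in B].

Definition generating_cone (R : numDomainType) (X : orderedLmodType R) : Prop :=
  [set a - b | a in poscone X & b in poscone X] = setT.
Arguments generating_cone {R} X.

Definition internal_points (R : numDomainType) (X : lmodType R) (A : set X) :
    set X :=
  [set e | A e /\ forall x : X, exists2 eps : R, 0 < eps &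
             forall a : R, - eps < a < eps -> A (e + a *: x)].

Definition dedekind_complete (R : numDomainType) (Y : orderedLmodType R) :
    Prop :=
  forall A : set Y, A !=set0 -> has_ubound A -> supremums A !=set0.
Arguments dedekind_complete {R} Y.

Definition positive_functional (R : numDomainType) (X : orderedLmodType R)
    (f : {scalar X}) : Prop :=
  forall x : X, 0 <= x -> 0 <= f x.

Definition regular_functional (R : numDomainType) (X : orderedLmodType R)
    (f : {scalar X}) : Prop :=
  exists g h : {scalar X},
    [/\ positive_functional g, positive_functional h &
        forall x, f x = g x - h x].

Definition cone_base (R : numDomainType) (X : orderedLmodType R) (B : set X) :
    Prop :=
  [/\ convex_set B,
      B `<=` poscone X `\ 0 &
      forall x, (poscone X `\ 0) x ->
        exists! p : X * R, [/\ B p.1, 0 < p.2 & x = p.2 *: p.1]].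

(* The length, in units of [x], of the trace of [B] on the line through [y] and
   [x + y]; for convex [B] this trace is a segment, and its length is the
   supremum of the distances between its points, possibly [+oo]. *)
Definition chord_length (R : realType) (X : lmodType R) (B : set X) (x y : X) :
    \bar R :=
  ereal_sup [set d | exists s t : R,
    [/\ B (y + s *: x), B (y + t *: x) & d = `|s - t|%:E]].

Definition bounded_aperture_on_parallel_lines (R : realType)
    (X : orderedLmodType R) : Prop :=
  exists2 B : set X, cone_base B &
    forall x : X, x != 0 -> exists2 c : R, 0 <= c &
      forall y, (B `\ x) y -> (chord_length B x y <= c%:E)%E.
Arguments bounded_aperture_on_parallel_lines {R} X.

Definition order_interval (R : numDomainType) (X : orderedLmodType R)
    (x y : X) : set X := [set` `[x, y]].

Definition riesz_decomposition (R : numDomainType) (X : orderedLmodType R) :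
    Prop :=
  forall x y : X, 0 <= x -> 0 <= y ->
    minkowski_sum (order_interval 0 x) (order_interval 0 y) =
    order_interval 0 (x + y).
Arguments riesz_decomposition {R} X.

(* [infimums S] and [supremums S] have at most one element; [infimums S m]
   reads: the infimum of [S] exists and equals [m]. *)
Definition strictly_separates (R : numDomainType) (X : lmodType R)
    (Y : orderedLmodType R) (f : X -> Y) (z : X) (A : set X) : Prop :=
  ((forall a, A a -> f z <= f a) /\
     (exists2 m, infimums (f @` A) m & f z < m)) \/
  ((forall a, A a -> f a <= f z) /\
     (exists2 m, supremums (f @` A) m & m < f z)).

Definition linear_space_of_maps (R : numDomainType) (X Y : lmodType R)
    (L : set (X -> Y)) : Prop :=
  [/\ forall f, L f -> linear f,
      L (fun=> 0) &
      forall (a : R) f g, L f -> L g -> L (fun x => a *: f x + g x)].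

Definition L_riesz_decomposition (R : numDomainType) (X Y : orderedLmodType R)
    (L : set (X -> Y)) : Prop :=
  forall x y : X, 0 <= x -> 0 <= y ->
    let S := minkowski_sum (order_interval 0 x) (order_interval 0 y) in
    forall z, (order_interval 0 (x + y) `\` S) z ->
      ~ exists2 f, L f & strictly_separates f z S.

(* Main.v *)
Require Import Defs.
From HB Require Import structures.
From mathcomp Require Import all_boot all_order all_algebra.
From mathcomp Require Import all_classical all_reals all_analysis.
From mathcomp Require Import ring lra.

Import Order.TTheory GRing.Theory Num.Theory.

Local Open Scope classical_set_scope.
Local Open Scope ring_scope.

(** If [X] has the Riesz decomposition property there is no point to separate,
so only one direction has content.  Suppose that some [z] in [[0, x + y]] lies
outside [S = [0, x] + [0, y]].  A member of [L] strictly separating a point from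
such a sum has to be found, though not necessarily for the same [x] and [y].

That [z] lies outside [S] means that the four inequalities [0 <= u],
[z - y <= u], [u <= x], [u <= z] have no common solution [u].  An infeasible
system of inequalities has a dual certificate ([interpolation_alternative]):
positive functionals [g1], [g2], [g3], [g4], not all zero, with
[g1 + g2 = g3 + g4] and [g3 x + g4 z <= g2 (z - y)].  The functional
[f = g3 - g1 = g2 - g4] is then regular by construction; from the first form
[f <= g3 x] on [[0, x]], from the second [f <= g2 y] on [[0, y]], so
[f <= m] on [S] for [m = g3 x + g2 y], while the certificate says exactly
[m <= f z].

This separation is not strict.  But every nonzero positive element is an order
unit, so a positive functional vanishing at one such element vanishes
identically, and this forces [m > 0] ([regular_separation]).  The element
[x + y - z] is an order unit too, so [z] stays below [k (x + y)] for some
[k < 1]; on [k S = [0, k x] + [0, k y]] the functional is at most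
[k m < m <= f z] ([regular_strict_separation]).  Multiplying [f] by the positive
vector of [Y] gives a member of [L], and Dedekind completeness supplies the
supremum of its values on [k S] that strict separation asks for.

The certificate comes from a Hahn-Banach argument on [X^4] phrased with wedges:
by Zorn's lemma a wedge missing [- e] grows to a wedge [M] missing [- e] with
[M] and [- M] covering the space ([wedge_half_space]), and if [e] is an order
unit such an [M] is the half-space of a functional, read off as a Dedekind cut
along the line spanned by [e] ([wedge_positive_functional]). *)

(** * Separating a wedge from a point *)

Definition wedge {R : numDomainType} {V : lmodType R} (Q : set V) : Prop :=
  [/\ Q 0, forall a b, Q a -> Q b -> Q (a + b) &
      forall (s : R) a, 0 <= s -> Q a -> Q (s *: a)].

(** The base wedge [Q] is joined to every member so that the empty chain, whose
union is not a wedge, needs no separate treatment. *)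
Lemma wedge_chain_union (R : numDomainType) (V : lmodType R) (Q : set V)
    (F : set (set V)) :
  wedge Q -> (forall A, F A -> wedge (A `|` Q)) -> total_on F subset ->
  wedge (\bigcup_(A in F) A `|` Q).
Proof.
move=> [Q0 QD QZ] FW Ftot.
have sub A : F A -> A `|` Q `<=` \bigcup_(A in F) A `|` Q.
  by move=> FA; apply: setSU; exact: bigcup_sup.
have in_member a : (\bigcup_(A in F) A `|` Q) a ->
    Q a \/ exists2 A, F A & (A `|` Q) a.
  by move=> [[A FA Aa]|Qa]; [right; exists A => //; left|left].
split; first by right.
- move=> a b /in_member [Qa|[A FA Aa]] /in_member [Qb|[B FB Bb]].
  + by right; exact: QD.
  + by have [_ D _] := FW B FB; apply: (sub B FB); apply: D => //; right.
  + by have [_ D _] := FW A FA; apply: (sub A FA); apply: D => //; right.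
  + have [AB|BA] := Ftot A B FA FB.
    * have [_ D _] := FW B FB; apply: (sub B FB); apply: D => //.
      exact: setSU AB _ Aa.
    * have [_ D _] := FW A FA; apply: (sub A FA); apply: D => //.
      exact: setSU BA _ Bb.
- move=> s a s0 /in_member [Qa|[A FA Aa]]; first by right; exact: QZ.
  by have [_ _ Z] := FW A FA; apply: (sub A FA); exact: Z.
Qed.

Lemma wedge_add_ray (R : numDomainType) (V : lmodType R) (Q : set V) (v : V) :
  wedge Q -> wedge [set a | exists q s, [/\ Q q, 0 <= s & a = q + s *: v]].
Proof.
move=> [Q0 QD QZ]; split.
- by exists 0, 0; split=> //; rewrite scale0r addr0.
- move=> _ _ [q [s [Qq s0 ->]]] [r [t [Qr t0 ->]]].
  exists (q + r), (s + t); split; [exact: QD|exact: addr_ge0|].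
  by rewrite scalerDl addrACA.
- move=> k _ k0 [q [s [Qq s0 ->]]].
  exists (k *: q), (k * s); split; [exact: QZ|exact: mulr_ge0|].
  by rewrite scalerDr scalerA.
Qed.

(** For a maximal [M], adding the ray of a [v] outside [M] must capture [- e].
If both [v] and [- v] were outside, this would give [- e = q + s v] and
[- e = r - t v]; eliminating [v] puts [- e] itself in [M]. *)
Lemma wedge_half_space {R : realFieldType} {V : lmodType R} {Q : set V}
    {e : V} :
  wedge Q -> ~ Q (- e) ->
  exists M, [/\ wedge M, Q `<=` M, ~ M (- e) & forall v, M v \/ M (- v)].
Proof.
move=> QW Qe.
pose P (A : set V) := wedge (A `|` Q) /\ ~ (A `|` Q) (- e).
have [F FP Ftot|A [[AW Ae] Amax]] := @Zorn_bigcup _ P.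
  split; first by apply: wedge_chain_union => // A /FP [].
  by move=> [[A FA Ae]|//]; have [_ []] := FP A FA; left.
set M := A `|` Q in AW Ae.
have absorb v : ~ M v ->
    exists q s, [/\ M q, 0 <= s & - e = q + s *: v].
  move=> Mv; pose B := [set a | exists q s, [/\ M q, 0 <= s & a = q + s *: v]].
  have MB : M `<=` B.
    by move=> a Ma; exists a, 0; split=> //; rewrite scale0r addr0.
  have BQ : B `|` Q = B.
    by apply/setUidPl => a Qa; apply: MB; right.
  apply: contrapT => Be; apply: (Amax B).
    split; first by move=> a Aa; apply: MB; left.
    move=> BA; apply: Mv; left; apply: BA; exists 0, 1.
    by split=> //; [case: AW|rewrite scale1r add0r].
  by split; rewrite BQ; [exact: wedge_add_ray|].
exists M; split=> //; first by move=> a; right.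
move=> v; have [?|/absorb] := pselect (M v); first by left.
move=> [q [s [Mq s0 eq1]]]; right; apply: contrapT => /absorb.
move=> [r [t [Mr t0 eq2]]]; apply: Ae; have [_ MD MZ] := AW.
have [s0'|s_neq0] := eqVneq s 0; first by rewrite eq1 s0' scale0r addr0.
have st0 : 0 < s + t by rewrite ltr_pwDl// lt_def s_neq0.
have -> : - e = (s + t)^-1 *: (t *: q + s *: r).
  apply: (scalerI (lt0r_neq0 st0)); rewrite scalerA divff ?lt0r_neq0// scale1r.
  rewrite scalerDl {1}eq2 eq1 !scalerDr !scalerN !scalerA (mulrC t s).
  by rewrite addrACA addNr addr0 addrC.
by apply: (MZ); [rewrite invr_ge0 ltW|apply: MD; apply: (MZ)].
Qed.

Lemma linear_functional_ex (R : pzRingType) (V : lmodType R) (f : V -> R) :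
  (forall a u v, f (a *: u + v) = a * f u + f v) ->
  exists g : {scalar V}, g =1 f.
Proof.
move=> flin.
pose fM := GRing.isLinear.Build R V R *%R f flin.
by exists (HB.pack f fM : {scalar V}).
Qed.

(** Modulo the half-space [M], each [v] has a unique height [h]: below it
[v - t e] is in [M], above it [t e - v] is.  The height is linear in [v]. *)
Lemma wedge_positive_functional {R : realType} {V : lmodType R} {Q : set V}
    {e : V} :
  wedge Q -> ~ Q (- e) -> (forall v, exists t : R, Q (t *: e - v)) ->
  exists2 g : {scalar V}, g e = 1 & forall v, Q v -> 0 <= g v.
Proof.
move=> QW Qe unit_e.
have [M [[M0 MD MZ] QM Me Mtot]] := wedge_half_space QW Qe.
have Mneg t : t < 0 -> ~ M (t *: e).
  move=> t0 Mt; apply: Me; have -> : - e = (- t)^-1 *: (t *: e).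
    by rewrite scalerA invrN mulNr mulVf ?lt_eqF// scaleN1r.
  by apply: MZ => //; rewrite invr_ge0 oppr_ge0 ltW.
have Mpos t : 0 <= t -> M (t *: e).
  by move=> t0; apply: MZ => //; have [//|/Me] := Mtot e.
(* [upper v h] says that [v] lies at height at most [h]; by symmetry, that the
   height is at least [h] is [upper (- v) (- h)]. *)
pose upper v h := forall d : R, 0 < d -> M ((h + d) *: e - v).
have upper_le v h k : upper (- v) (- h) -> upper v k -> h <= k.
  move=> vh vk; rewrite leNgt; apply/negP => kh.
  pose d := (h - k) / 3.
  have d0 : 0 < d by rewrite divr_gt0 // subr_gt0.
  apply: (@Mneg (k + d + (- h + d))); first by rewrite /d; lra.
  by move: (MD _ _ (vk d d0) (vh d d0)); rewrite opprK addrACA addNr addr0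
    -scalerDl.
pose cut v h := upper v h /\ upper (- v) (- h).
have cut_inj v h k : cut v h -> cut v k -> h = k.
  move=> [hu hl] [ku kl]; apply/eqP.
  by rewrite eq_le (upper_le v h k)// (upper_le v k h).
have cut_ex v : exists h, cut v h.
  pose S := [set t | M (t *: e - v)].
  have S0 : S !=set0 by have [t /QM] := unit_e v; exists t.
  have [b /QM] := unit_e (- v); rewrite opprK => Mb.
  have Slb : lbound S (- b).
    move=> t St; rewrite leNgt; apply/negP => tb.
    apply: (@Mneg (t + b)); first by lra.
    by move: (MD _ _ St Mb); rewrite addrACA addNr addr0 -scalerDl.
  exists (inf S); split=> d d0.
    have [|t St ts] := @inf_adherent _ S d d0.
      by split=> //; exists (- b).
    have -> : (inf S + d) *: e - v = (inf S + d - t) *: e + (t *: e - v).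
      by rewrite addrA -scalerDl subrK.
    by apply: MD => //; apply: Mpos; lra.
  have [//|] := Mtot ((- inf S + d) *: e - - v).
  rewrite opprB addrC -scaleNr opprD opprK => Sd.
  have : inf S <= inf S - d by apply: ge_inf => //; exists (- b).
  by lra.
have upper_lin a v w h k : cut v h -> upper w k ->
    upper (a *: v + w) (a * h + k).
  move=> [vu vl] wu d d0; pose d' := d / (`|a| + 1).
  have a1 : 0 < `|a| + 1 by rewrite ltr_wpDl.
  have d'0 : 0 < d' by rewrite divr_gt0.
  have dE : d = `|a| * d' + d' by rewrite /d'; field; rewrite lt0r_neq0.
  have [a0|a0] := leP 0 a.
    move: (MD _ _ (MZ _ _ a0 (vu d' d'0)) (wu d' d'0)).
    rewrite scalerBr scalerA addrACA -opprD -scalerDl.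
    by congr (M (_ *: _ - _)); rewrite dE ger0_norm//; ring.
  have a0' : 0 <= - a by rewrite oppr_ge0 ltW.
  move: (MD _ _ (MZ _ _ a0' (vl d' d'0)) (wu d' d'0)).
  rewrite scalerBr scalerN opprK scalerA addrACA scaleNr -opprD -scalerDl.
  by congr (M (_ *: _ - _)); rewrite dE ltr0_norm//; ring.
have cut_lin a v w h k : cut v h -> cut w k -> cut (a *: v + w) (a * h + k).
  move=> vh wk; split; first by apply: upper_lin => //; case: wk.
  rewrite !opprD -scaleNr -mulNr; apply: upper_lin => //; by case: wk.
have [f fP] := choice cut_ex.
have [g gf] : exists g : {scalar V}, g =1 f.
  apply: linear_functional_ex => a u v.
  by apply: (cut_inj (a *: u + v)) => //; exact: cut_lin.
exists g => [|v Qv]; rewrite gf.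
  apply: (cut_inj e) => //; split=> d d0.
    by rewrite scalerDl scale1r addrC addKr; apply: Mpos; exact: ltW.
  rewrite scalerDl scaleN1r opprK addrAC addNr add0r.
  by apply: Mpos; exact: ltW.
have [up _] := fP v.
rewrite leNgt; apply/negP => fv.
(* Halfway between [f v] and [0] the multiple of [e] is still negative. *)
apply: (@Mneg (f v + - f v / 2)); first by lra.
have h0 : 0 < - f v / 2 by lra.
by move: (MD _ _ (up _ h0) (QM _ Qv)); rewrite subrK.
Qed.

(** * Ordered linear spaces *)

Section OrderedModules.
Context {R : realFieldType} {X : orderedLmodType R}.
Implicit Types (x y z u v : X) (k s t : R).

Lemma ole_addr2 x y z : (x + z <= y + z) = (x <= y).
Proof.
apply/idP/idP => [xy|]; last exact: olerD2r.
by rewrite -(addrK z x) -(addrK z y); exact: olerD2r.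
Qed.

Lemma ole_add x y u v : x <= y -> u <= v -> x + u <= y + v.
Proof.
move=> xy uv; apply: (@le_trans _ _ (y + u)); first by rewrite ole_addr2.
by rewrite !(addrC y) ole_addr2.
Qed.

Lemma osubr_ge0 x y : (0 <= y - x) = (x <= y).
Proof. by rewrite -(ole_addr2 0 _ x) add0r subrK. Qed.

Lemma oler_subl x y z : (x - y <= z) = (x <= z + y).
Proof. by rewrite -(ole_addr2 (x - y) z y) subrK. Qed.

Lemma oscaler_ge0 k x : 0 <= k -> 0 <= x -> 0 <= k *: x.
Proof. by move=> k0 x0; rewrite -(scaler0 _ k); exact: olerZ2l. Qed.

Lemma oler_scale_pos k x y : 0 < k -> (k *: x <= k *: y) = (x <= y).
Proof.
move=> k0; apply/idP/idP => [kxy|]; last exact/olerZ2l/ltW.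
rewrite -(scalerK (lt0r_neq0 k0) x) -(scalerK (lt0r_neq0 k0) y).
by apply: olerZ2l => //; rewrite invr_ge0 ltW.
Qed.

Lemma oler_scale_wpos2r x s t : 0 <= x -> s <= t -> s *: x <= t *: x.
Proof.
move=> x0 st; rewrite -osubr_ge0 -scalerBl -(scaler0 _ (t - s)).
by apply: olerZ2l => //; rewrite subr_ge0.
Qed.

Lemma oltr_scale_pos2r x s t : 0 < x -> s < t -> s *: x < t *: x.
Proof.
move=> x0 st; rewrite lt_def oler_scale_wpos2r ?ltW// andbT.
by rewrite -subr_eq0 -scalerBl scaler_eq0 subr_eq0 !gt_eqF.
Qed.

Definition order_unit (e : X) := forall v, exists t : R, v <= t *: e.

Lemma internal_order_unit e : internal_points (poscone X) e -> order_unit e.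
Proof.
move=> [_ e_int] v; have [eps eps0 in_cone] := e_int (- v).
have h0 : 0 < eps / 2 by rewrite divr_gt0.
have : poscone X (e + (eps / 2) *: - v) by apply: in_cone; lra.
rewrite scalerN /poscone /= osubr_ge0 => ve; exists (eps / 2)^-1.
by rewrite -(oler_scale_pos _ _ _ h0) scalerKV ?lt0r_neq0.
Qed.

Lemma positive_functional_le (g : {scalar X}) x y :
  positive_functional g -> x <= y -> g x <= g y.
Proof.
by move=> gpos xy; rewrite -subr_ge0 -raddfB; apply: gpos; rewrite osubr_ge0.
Qed.

Lemma positive_functional_order_unit_eq0 (g : {scalar X}) e :
  positive_functional g -> order_unit e -> g e = 0 -> g =1 fun=> 0.
Proof.
move=> gpos e_unit ge0 v; have g_le0 w : g w <= 0.
  have [t /(positive_functional_le _ _ _ gpos)] := e_unit w.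
  by rewrite linearZ /= ge0 mulr0.
by apply/eqP; rewrite eq_le g_le0 -oppr_le0 -raddfN g_le0.
Qed.

Lemma mem_order_interval x y z : order_interval x y z <-> x <= z /\ z <= y.
Proof.
rewrite /order_interval /= in_itv /=; split; first by move/andP.
by move=> [-> ->].
Qed.

(** In [z = u + b] the first summand determines the second, and the constraints
on [b] become constraints on [u]: decomposing [z] is interpolating [u] between
[0], [z - y] and [x], [z]. *)
Lemma minkowski_order_intervalP x y z :
  minkowski_sum (order_interval 0 x) (order_interval 0 y) z <->
  exists u, [/\ 0 <= u, z - y <= u, u <= x & u <= z].
Proof.
split=> [[a /mem_order_interval [a0 ax] [b /mem_order_interval [b0 yb]] <-]|].
  exists a; split=> //; first by rewrite oler_subl ole_add.
  by rewrite -{1}[a]addr0 ole_add.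
move=> [u [u0 zyu ux uz]]; exists u; first exact/mem_order_interval.
exists (z - u); last by rewrite addrC subrK.
apply/mem_order_interval; rewrite osubr_ge0; split=> //.
by rewrite oler_subl addrC -oler_subl.
Qed.

Lemma minkowski_order_interval_scale k x y v : 0 < k ->
  minkowski_sum (order_interval 0 (k *: x)) (order_interval 0 (k *: y))
    (k *: v) ->
  minkowski_sum (order_interval 0 x) (order_interval 0 y) v.
Proof.
move=> k0 /minkowski_order_intervalP [u].
have -> : u = k *: (k^-1 *: u) by rewrite scalerKV ?lt0r_neq0.
rewrite -scalerBr -{1}(scaler0 _ k) !oler_scale_pos// => -[? ? ? ?].
by apply/minkowski_order_intervalP; exists (k^-1 *: u).
Qed.

Lemma minkowski_order_interval_sub x y :
  minkowski_sum (order_interval 0 x) (order_interval 0 y)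
    `<=` order_interval 0 (x + y).
Proof.
move=> _ [a /mem_order_interval [a0 ax] [b /mem_order_interval [b0 yb]] <-].
by apply/mem_order_interval; rewrite -[0]addr0 !ole_add.
Qed.

(** The perturbations [v] under which interpolating between [l1], [l2] and [u1],
[u2] becomes feasible, homogenised by the factor [s] so as to form a wedge.
Positive [v] relax the constraints. *)
Definition relaxed_interpolation (l1 l2 u1 u2 : X) : set (X * X * X * X) :=
  [set v | exists (u : X) (s : R),
    [/\ 0 <= s,
        s *: l1 <= u + v.1.1.1, s *: l2 <= u + v.1.1.2,
        u <= s *: u1 + v.1.2 & u <= s *: u2 + v.2]].

Lemma relaxed_interpolation_wedge (l1 l2 u1 u2 : X) :
  wedge (relaxed_interpolation l1 l2 u1 u2).
Proof.
split.
- by exists 0, 0; rewrite !scale0r !addr0.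
- move=> a b [u [s [s0 a1 a2 a3 a4]]] [v [t [t0 b1 b2 b3 b4]]].
  exists (u + v), (s + t); split; first exact: addr_ge0;
    by rewrite scalerDl /= addrACA; exact: ole_add.
- move=> k a k0 [u [s [s0 a1 a2 a3 a4]]].
  exists (k *: u), (k * s); split; first exact: mulr_ge0;
    by rewrite -scalerA /= -scalerDr; exact: olerZ2l.
Qed.

End OrderedModules.
Arguments order_unit {R X} e.

(** * Separation in an ordered linear space *)

(** A theorem of the alternative.  If no interpolating element exists, then
tightening all four constraints by [e] is infeasible in the relaxed system as
well, and the functional separating this perturbation from the wedge has the
[g_i] as its components: positive perturbations make them positive, shifting all
constraints together makes [g1 + g2 = g3 + g4], and the perturbation
[(l1, l2, - u1, - u2)], feasible for [u = 0] and [s = 1], gives the last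
inequality. *)
Lemma interpolation_alternative {R : realType} {X : orderedLmodType R}
    {e : X} (l1 l2 u1 u2 : X) : 0 < e -> order_unit e ->
  (exists u, [/\ l1 <= u, l2 <= u, u <= u1 & u <= u2]) \/
  (exists g1 g2 g3 g4 : {scalar X},
    [/\ [/\ positive_functional g1, positive_functional g2,
            positive_functional g3 & positive_functional g4],
        g1 e + g2 e + g3 e + g4 e = 1,
        forall v, g1 v + g2 v = g3 v + g4 v &
        g3 u1 + g4 u2 <= g1 l1 + g2 l2]).
Proof.
move=> e0 e_unit; pose Q := relaxed_interpolation l1 l2 u1 u2.
pose E : X * X * X * X := (e, e, e, e).
have [|noint] := pselect (exists u, [/\ l1 <= u, l2 <= u, u <= u1 & u <= u2]);
  [by left|right].
have QE : ~ Q (- E).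
  have le_sube v : v - e <= v by rewrite oler_subl -{1}[v]addr0 ole_add// ltW.
  (* [s = 0] would give [e <= u <= - e]; otherwise [u / s] interpolates. *)
  move=> [u [s [s0 /= lu1 lu2 uu1 uu2]]]; have [s_eq0|s_neq0] := eqVneq s 0.
    move: lu1 uu1; rewrite s_eq0 !scale0r add0r osubr_ge0 => eu ue.
    have : e + e <= 0 by rewrite -(addNr e) ole_addr2; exact: le_trans eu ue.
    have ee : e <= e + e by rewrite -{1}[e]addr0 ole_add// ltW.
    by move=> /(le_trans ee) /(lt_le_trans e0); rewrite ltxx.
  have sgt0 : 0 < s by rewrite lt_def s_neq0.
  apply: noint; exists (s^-1 *: u).
  have us : u = s *: (s^-1 *: u) by rewrite scalerKV.
  split; rewrite -(oler_scale_pos _ _ _ sgt0) -us.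
  - exact: le_trans lu1 (le_sube _).
  - exact: le_trans lu2 (le_sube _).
  - exact: le_trans uu1 (le_sube _).
  - exact: le_trans uu2 (le_sube _).
have E_unit v : exists t : R, Q (t *: E - v).
  case: v => [[[v1 v2] v3] v4].
  have [t1 vt1] := e_unit v1; have [t2 vt2] := e_unit v2.
  have [t3 vt3] := e_unit v3; have [t4 vt4] := e_unit v4.
  pose t := `|t1| + `|t2| + `|t3| + `|t4|.
  have n1 := normr_ge0 t1; have n2 := normr_ge0 t2.
  have n3 := normr_ge0 t3; have n4 := normr_ge0 t4.
  have up r v : v <= r *: e -> `|r| <= t -> v <= t *: e.
    move=> /le_trans vr rt; apply: vr; apply: oler_scale_wpos2r (ltW e0) _.
    exact: le_trans (ler_norm r) rt.
  exists t, 0, 0; rewrite !scale0r !add0r /= !osubr_ge0.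
  split=> //; [apply: up vt1 _|apply: up vt2 _|apply: up vt3 _|apply: up vt4 _];
    by rewrite /t; lra.
have [H HE HQ] := wedge_positive_functional
  (relaxed_interpolation_wedge l1 l2 u1 u2) QE E_unit.
have pull (i : X -> X * X * X * X) :
    (forall k a b, i (k *: a + b) = k *: i a + i b) ->
    exists g : {scalar X}, g =1 fun a => H (i a).
  by move=> i_lin; apply: linear_functional_ex => k a b; rewrite i_lin linearP.
have [|g1 g1E] := pull (fun a => (a, 0, 0, 0)).
  move=> k a b.
  by rewrite -[RHS]/(k *: a + b, k *: 0 + 0, k *: 0 + 0, k *: 0 + 0)
    scaler0 addr0.
have [|g2 g2E] := pull (fun a => (0, a, 0, 0)).
  move=> k a b.
  by rewrite -[RHS]/(k *: 0 + 0, k *: a + b, k *: 0 + 0, k *: 0 + 0)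
    scaler0 addr0.
have [|g3 g3E] := pull (fun a => (0, 0, a, 0)).
  move=> k a b.
  by rewrite -[RHS]/(k *: 0 + 0, k *: 0 + 0, k *: a + b, k *: 0 + 0)
    scaler0 addr0.
have [|g4 g4E] := pull (fun a => (0, 0, 0, a)).
  move=> k a b.
  by rewrite -[RHS]/(k *: 0 + 0, k *: 0 + 0, k *: 0 + 0, k *: a + b)
    scaler0 addr0.
have Hsplit a b c d : H (a, b, c, d) = g1 a + g2 b + g3 c + g4 d.
  rewrite g1E g2E g3E g4E -!linearD; congr (H _).
  by rewrite -[RHS]/(a + 0 + 0 + 0, 0 + b + 0 + 0, 0 + 0 + c + 0, 0 + 0 + 0 + d)
    !addr0 !add0r.
exists g1, g2, g3, g4; split.
- split=> v v0; rewrite ?g1E ?g2E ?g3E ?g4E; apply: HQ; exists 0, 0;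
    by rewrite !scale0r !add0r.
- by rewrite -Hsplit.
- have diag v : g3 v + g4 v <= g1 v + g2 v.
    have : 0 <= H (v, v, - v, - v).
      by apply: HQ; exists (- v), 0; rewrite !scale0r !add0r /= addNr.
    by rewrite Hsplit !raddfN; lra.
  move=> v; apply/eqP; rewrite eq_le diag andbT.
  by have := diag (- v); rewrite !raddfN; lra.
- have : 0 <= H (l1, l2, - u1, - u2).
    by apply: HQ; exists 0, 1; rewrite !scale1r !add0r /= !subrr.
  by rewrite Hsplit !raddfN; lra.
Qed.

(** Writing [f] both as [g3 - g1] and as [g2 - g4] bounds it on each of the two
intervals by a single positive functional.  If the bound [m] were [0], then
[g3], [g2] and hence [g4] would vanish at the order units [x], [y], [z], so all
four functionals would be zero. *)
Lemma regular_separation {R : realType} {X : orderedLmodType R} {x y z : X} :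
  (forall e : X, 0 < e -> order_unit e) -> 0 < x -> 0 < y -> 0 < z ->
  ~ minkowski_sum (order_interval 0 x) (order_interval 0 y) z ->
  exists (f : {scalar X}) (m : R),
    [/\ regular_functional f, 0 < m, m <= f z &
        forall a, minkowski_sum (order_interval 0 x) (order_interval 0 y) a ->
          f a <= m].
Proof.
move=> unitX x0 y0 z0 zS.
have [/minkowski_order_intervalP//|] :=
  interpolation_alternative 0 (z - y) x z x0 (unitX x x0).
move=> [g1 [g2 [g3 [g4 [[p1 p2 p3 p4] sum1 diag]]]]].
rewrite raddf0 add0r raddfB /= => cert.
have [f fE] : exists f : {scalar X}, f =1 fun v => g3 v - g1 v.
  apply: linear_functional_ex => k u v.
  by rewrite (linearP g3) (linearP g1) /=; ring.
have fE' v : f v = g2 v - g4 v by rewrite fE; have := diag v; lra.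
have g3x : 0 <= g3 x by apply: p3; exact: ltW.
have g2y : 0 <= g2 y by apply: p2; exact: ltW.
exists f, (g3 x + g2 y); split.
- by exists g3, g1.
- rewrite lt_def addr_ge0// andbT; apply/negP => /eqP m0.
  have /(positive_functional_order_unit_eq0 _ _ p3 (unitX _ x0)) g30 : g3 x = 0.
    by lra.
  have /(positive_functional_order_unit_eq0 _ _ p2 (unitX _ y0)) g20 : g2 y = 0.
    by lra.
  have /(positive_functional_order_unit_eq0 _ _ p4 (unitX _ z0)) g40 : g4 z = 0.
    have : 0 <= g4 z by apply: p4; exact: ltW.
    by move: cert; rewrite !g20 !g30; lra.
  by have := diag x; move: sum1; rewrite g20 g30 g40; lra.
- by rewrite fE'; lra.
- move=> _ [a /mem_order_interval [a0 ax] [b /mem_order_interval [b0 yb]] <-].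
  have fa : f a <= g3 x.
    rewrite fE; have := positive_functional_le _ _ _ p3 ax.
    by have := p1 a a0; lra.
  have fb : f b <= g2 y.
    rewrite fE'; have := positive_functional_le _ _ _ p2 yb.
    by have := p4 b b0; lra.
  by rewrite raddfD /= lerD.
Qed.

(** Shrinking [x] and [y] by a factor close to [1] lowers the bound on the sum
of the intervals by that factor, while [z] remains in the order interval. *)
Lemma regular_strict_separation {R : realType} {X : orderedLmodType R}
    {x y z : X} :
  (forall e : X, 0 < e -> order_unit e) -> 0 <= x -> 0 <= y ->
  order_interval 0 (x + y) z ->
  ~ minkowski_sum (order_interval 0 x) (order_interval 0 y) z ->
  exists (f : {scalar X}) (k m : R),
    [/\ regular_functional f, 0 < k,
        order_interval 0 (k *: x + k *: y) z, m < f z &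
        forall a, minkowski_sum (order_interval 0 (k *: x))
                    (order_interval 0 (k *: y)) a -> f a <= m].
Proof.
move=> unitX x0 y0 /mem_order_interval [z0 zle] zS.
have x_gt0 : 0 < x.
  rewrite lt_def x0 andbT; apply: contra_notN zS => /eqP x_eq0.
  apply/minkowski_order_intervalP; exists 0.
  by rewrite x_eq0 in zle *; rewrite add0r in zle; rewrite oler_subl add0r.
have y_gt0 : 0 < y.
  rewrite lt_def y0 andbT; apply: contra_notN zS => /eqP y_eq0.
  apply/minkowski_order_intervalP; exists z.
  by rewrite y_eq0 subr0 in zle *; rewrite addr0 in zle.
have z_gt0 : 0 < z.
  rewrite lt_def z0 andbT; apply: contra_notN zS => /eqP ->.
  by apply/minkowski_order_intervalP; exists 0; rewrite oler_subl add0r.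
have gap : 0 < x + y - z.
  rewrite lt_def osubr_ge0 zle andbT.
  apply: contra_notN zS => /eqP /subr0_eq xyz.
  have xz : x <= z by rewrite -xyz -{1}[x]addr0 ole_add.
  by apply/minkowski_order_intervalP; exists x; rewrite -{1}xyz addrK.
have [f [m [f_reg m0 mz fS]]] := regular_separation unitX x_gt0 y_gt0 z_gt0 zS.
(* [x + y - z] dominates [(x + y) / t'], whence [k = 1 - 1 / t'];
   taking [t'] at least [2] keeps [k] positive. *)
have [k /andP[k0 k1] zk] : exists2 k : R, 0 < k < 1 & z <= k *: x + k *: y.
  have [t xyt] := unitX _ gap (x + y).
  pose t' := Num.max t 2; have t'2 : 2 <= t' by rewrite le_max lexx orbT.
  have t'0 : 0 < t' by lra.
  have t'V : 0 < t'^-1 < 1 by rewrite invr_gt0 t'0 invf_lt1//; lra.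
  exists (1 - t'^-1); first by lra.
  rewrite -scalerDr scalerBl scale1r -osubr_ge0 addrAC osubr_ge0.
  rewrite -(oler_scale_pos _ _ _ t'0) scalerKV ?lt0r_neq0//.
  apply: le_trans xyt _; apply: oler_scale_wpos2r (ltW gap) _.
  by rewrite le_max lexx.
exists f, k, (k * m); split=> //.
- exact/mem_order_interval.
- by apply: lt_le_trans mz; rewrite gtr_pMl.
- move=> a S'a; have kk : k *: (k^-1 *: a) = a by rewrite scalerKV ?lt0r_neq0.
  rewrite -kk linearZ /= ler_pM2l//; apply: fS.
  by apply: (minkowski_order_interval_scale k); rewrite ?kk.
Qed.

Theorem theorem7 (R : realType) (X Y : orderedLmodType R) (L : set (X -> Y))
    (X_strict : poscone X = [set 0] `|` internal_points (poscone X))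
    (X_gen : generating_cone X)
    (X_aperture : bounded_aperture_on_parallel_lines X)
    (Y_complete : dedekind_complete Y)
    (Y_gen : generating_cone Y)
    (L_linear : linear_space_of_maps L)
    (L_rich : exists2 y0 : Y, 0 < y0 &
       forall f : {scalar X}, regular_functional f -> L (fun x => f x *: y0)) :
  riesz_decomposition X <-> L_riesz_decomposition L.
Proof.
split=> [rdp x y x0 y0 S z [zxy]|lrdp x y x0 y0].
  by rewrite /S rdp.
apply/seteqP; split; first exact: minkowski_order_interval_sub.
move=> z zxy; apply: contrapT => zS.
have unitX (e : X) : 0 < e -> order_unit e.
  move=> e0; apply: internal_order_unit.
  have : poscone X e by exact: ltW.
  by rewrite {1}X_strict => -[ee|//]; move: e0; rewrite ee ltxx.
have [f [k [m [f_reg k0 zk mz fS]]]] :=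
  regular_strict_separation unitX x0 y0 zxy zS.
have kx0 : 0 <= k *: x by exact: oscaler_ge0 (ltW k0) x0.
have ky0 : 0 <= k *: y by exact: oscaler_ge0 (ltW k0) y0.
have [w w0 Lw] := L_rich.
pose S := minkowski_sum (order_interval 0 (k *: x)) (order_interval 0 (k *: y)).
have ubS : ubound [set f a *: w | a in S] (m *: w).
  by move=> _ [a Sa <-]; apply: oler_scale_wpos2r (ltW w0) (fS a Sa).
have [b bsup] : supremums [set f a *: w | a in S] !=set0.
  apply: Y_complete; last by exists (m *: w).
  exists (f 0 *: w), 0 => //; apply/minkowski_order_intervalP; exists 0.
  by rewrite oler_subl add0r.
apply: (lrdp _ _ kx0 ky0 z).
  by split=> // /fS /(lt_le_trans mz); rewrite ltxx.
exists (fun v => f v *: w); first exact: Lw.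
right; split.
  move=> a /fS fa; apply: oler_scale_wpos2r (ltW w0) _.
  exact: le_trans fa (ltW mz).
exists b => //; apply: le_lt_trans (oltr_scale_pos2r _ _ _ w0 mz).
by case: bsup => _; apply.
Qed.
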